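(* Suppose that $\mathcal{D}=(\mathcal{P},\mathcal{B})$ is a symmetric $(v,k,\lambda)$ design with $\lambda$ prime admitting a flag-transitive and point-imprimitive automorphism group $G$. If $G$ leaves invariant a non-trivial partition $\mathcal{C}$ of $\mathcal{P}$ with $d$ classes of size $c$, then there is a constant $l$ such that, for each $B\in\mathcal{B}$ and $\Delta\in\mathcal{C}$, $|B\cap\Delta|\in\{0,l\}$, and one of the following holds: (a) $k\le \lambda(\lambda-3)/2$; (b) $(v,k,\lambda)=(\lambda^2(\lambda+2),\lambda(\lambda+1),\lambda)$ with $(c,d,l)=(\lambda^2,\lambda+2,\lambda)$ or $(\lambda+2,\lambda^2,2)$; (c) $(v,k,\lambda,c,d,l)=\left(\frac{(\lambda+6)(\lambda^2+4\lambda-1)}{4},\ \frac{\lambda(\lambda+5)}{2},\ \lambda,\ \lambda+6,\ \frac{\lambda^2+4\lambda-1}{4},\ 3\right)$, where $\lambda\equiv 1$ or $3 \pmod 6$.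
   Context: All groups and incidence structures are finite. A symmetric $(v,k,\lambda)$ design is a pair $\mathcal{D}=(\mathcal{P},\mathcal{B})$ where $\mathcal{P}$ is a set of $v$ points and $\mathcal{B}$ is a set of $v$ blocks, such that each block is a $k$-subset of $\mathcal{P}$ and any two distinct points are contained in exactly $\lambda$ blocks (equivalently every point is in exactly $k$ blocks and any two distinct blocks meet in exactly $\lambda$ points). A flag is an incident point-block pair. An automorphism is a permutation of the points that permutes the blocks and preserves incidence; an automorphism group of $\mathcal{D}$ is a group of automorphisms (not necessarily the full one). It is flag-transitive if it is transitive on flags, and point-imprimitive if it acts (transitively but) imprimitively on $\mathcal{P}$. A partition of $\mathcal{P}$ is non-trivial if it has more than one class and its classes have size greater than $1$. *)

(* Defs.v *)
From mathcomp Require Import all_boot all_order all_fingroup all_algebra all_solvable.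

Set Implicit Arguments.
Unset Strict Implicit.
Unset Printing Implicit Defensive.

Import GroupScope.

Section SymmetricDesigns.

Variable T : finType.

(* No non-degeneracy condition such as lam < k < v - 1 is imposed. *)
Record symmetric_design (B : {set {set T}}) (v k lam : nat) : Prop :=
  SymmetricDesign {
    card_points : #|T| = v;
    card_blocks : #|B| = v;
    card_block : forall b, b \in B -> #|b| = k;
    card_blocks_through2 : forall x y : T, x != y ->
      #|[set b in B | (x \in b) && (y \in b)]| = lam
  }.

(* Incidence is membership, so a permutation of the points acts on the blocks *)
(* through its setwise action, and it is an automorphism if it stabilizes B.  *)
Definition automorphism_group (B : {set {set T}}) (G : {group {perm T}}) :=
  [acts G, on B | 'P^*].

Definition flag (B : {set {set T}}) (x : T) (b : {set T}) :=
  (b \in B) && (x \in b).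

Definition flag_transitive (B : {set {set T}}) (G : {group {perm T}}) : Prop :=
  forall x b y b', flag B x b -> flag B y b' ->
  exists2 g, g \in G & g x = y /\ g @: b = b'.

Definition point_imprimitive (G : {group {perm T}}) :=
  [transitive G, on [set: T] | 'P] && ~~ [primitive G, on [set: T] | 'P].

End SymmetricDesigns.

(* Main.v *)
Require Import Defs.
From mathcomp Require Import all_boot all_order all_fingroup all_algebra all_solvable.
From mathcomp Require Import zify.
Import GRing.Theory Num.Theory.

Set Implicit Arguments.
Unset Strict Implicit.

(** Flag-transitivity forces every block to meet every class in [0] or [l]
    points.  Counting the pairs consisting of a block and an ordered pair of its
    points, in three ways, gives
    [k (l - 1) = lam (c - 1)] (a point and the rest of its class),
    [k (k - l) = lam c (d - 1)] (a point and the points outside its class) and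
    [l ^ 2 | lam c ^ 2] (two distinct classes); moreover [l | k], because a block
    is the disjoint union of its traces on the classes.

    As [lam] is prime, the third relation gives [l | c].  Reducing the first one
    modulo [l] then yields [l | lam], so [l = lam], and the first two relations
    determine everything else: [k = lam (lam + 1)], [c = lam ^ 2] and
    [d = lam + 2].  Hence the first alternative of the second case of the
    trichotomy always holds. *)

Section Counting.

Variables (T : finType) (B : {set {set T}}).

Lemma card_setI_sum (b X : {set T}) : #|b :&: X| = \sum_(x in X) (x \in b).
Proof.
rewrite -sum1_card big_mkcond [RHS]big_mkcond.
by apply: eq_bigr => x _; rewrite inE; case: (x \in b); case: (x \in X).
Qed.

Lemma sum_card_setI2 (X Y : {set T}) :
  \sum_(b in B) #|b :&: X| * #|b :&: Y| =
  \sum_(x in X) \sum_(y in Y) #|[set b in B | (x \in b) && (y \in b)]|.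
Proof.
have -> : \sum_(b in B) #|b :&: X| * #|b :&: Y| =
    \sum_(b in B) \sum_(x in X) \sum_(y in Y) (x \in b) * (y \in b).
  apply: eq_bigr => b _; rewrite !card_setI_sum big_distrl.
  by apply: eq_bigr => x _; rewrite big_distrr.
rewrite exchange_big; apply: eq_bigr => x _.
rewrite exchange_big; apply: eq_bigr => y _.
rewrite -sum1_card big_mkcond [RHS]big_mkcond; apply: eq_bigr => b _.
by rewrite !inE; case: (b \in B); case: (x \in b); case: (y \in b).
Qed.

Variables v k lam : nat.
Hypothesis hD : symmetric_design B v k lam.

Lemma sum_card_setI2_disjoint (X Y : {set T}) : [disjoint X & Y] ->
  \sum_(b in B) #|b :&: X| * #|b :&: Y| = lam * (#|X| * #|Y|).
Proof.
move=> dXY; rewrite sum_card_setI2.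
rewrite (eq_bigr (fun=> #|Y| * lam)) => [|x xX].
  by rewrite sum_nat_const mulnA mulnC.
rewrite (eq_bigr (fun=> lam)) ?sum_nat_const // => y yY.
rewrite (card_blocks_through2 hD) //.
by apply: contraTneq yY => <-; rewrite (disjointFr dXY).
Qed.

(** Taking [X = [set x]] leaves only the blocks through [x], so a set [Y] whose
    trace has the same size on all of them can be counted through [x]. *)
Lemma count_through_point (x : T) (Y : {set T}) (n : nat) : x \notin Y ->
  (forall b, b \in B -> x \in b -> #|b :&: Y| = n) ->
  #|[set b in B | x \in b]| * n = lam * #|Y|.
Proof.
move=> xNY hn; have := sum_card_setI2_disjoint (X := [set x]) (Y := Y).
rewrite disjoints1 xNY cards1 mul1n => <- //.
rewrite -sum_nat_const big_mkcond [RHS]big_mkcond; apply: eq_bigr => b _.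
rewrite !inE card_setI_sum big_set1; case: (boolP (b \in B)) => //= bB.
by case: (boolP (x \in b)) => [xb|_]; rewrite ?mul0n // mul1n hn.
Qed.

(** The number of blocks through a point is determined by
    [r (k - 1) = lam (v - 1)], and its average is [k] since there are as many
    blocks as points. *)
Lemma card_blocks_through (x : T) : 0 < lam -> 1 < v ->
  #|[set b in B | x \in b]| = k.
Proof.
move=> lam_gt0 v_gt1.
have rP (y : T) : #|[set b in B | y \in b]| * k.-1 = lam * v.-1.
  have := count_through_point (x := y) (Y := [set~ y]) (n := k.-1).
  rewrite !inE eqxx cardsC1 (card_points hD); apply=> // b bB yb.
  by rewrite -setDE -(card_block hD bB) [in RHS](cardsD1 y) yb.
have sum_r : \sum_(y : T) #|[set b in B | y \in b]| = v * k.
  rewrite -(card_blocks hD) -sum_nat_const.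
  under eq_bigr do rewrite -sum1dep_card.
  rewrite (exchange_big_dep (mem B)) /=; last by move=> ? ? _ /andP[].
  apply: eq_bigr => b bB; rewrite -(card_block hD bB) -sum1_card.
  by apply: eq_bigl => y; rewrite bB.
have kP : k * k.-1 = lam * v.-1.
  apply/eqP; rewrite -(@eqn_pmul2l v) ?(ltnW v_gt1) // mulnA -sum_r big_distrl /=.
  by under eq_bigr do rewrite rP; rewrite sum_nat_const (card_points hD).
have k1_gt0 : 0 < k.-1 by case: (k.-1) kP => //; nia.
by apply/eqP; rewrite -(eqn_pmul2r k1_gt0) rP kP.
Qed.

End Counting.

Lemma card_sum_partition {T : finType} {C : {set {set T}}} (b : {set T}) :
  partition C [set: T] -> #|b| = \sum_(A in C) #|b :&: A|.
Proof.
move=> hC; rewrite -[b in LHS]setIT card_setI_sum (set_partition_big _ hC).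
by apply: eq_bigr => A _; rewrite card_setI_sum.
Qed.

(** Two non-empty traces are carried to one another by an automorphism sending a
    flag to a flag: the class of the first point must go to the class of the
    second, as classes are permuted and disjoint. *)
Lemma flag_transitive_trace (T : finType) (B C : {set {set T}}) (G : {group {perm T}})
    (b b' A A' : {set T}) (x y : T) :
  flag_transitive B G -> trivIset C -> [acts G, on C | 'P^*] ->
  b \in B -> b' \in B -> A \in C -> A' \in C ->
  x \in b :&: A -> y \in b' :&: A' -> #|b :&: A| = #|b' :&: A'|.
Proof.
move=> hflag tC hGC bB b'B AC A'C /setIP[xb xA] /setIP[yb' yA'].
have [||g gG [gx gb]] := hflag x b y b'; rewrite /flag ?bB ?b'B //.
have gAC : g @: A \in C by have := acts_act hGC gG A; rewrite AC.
have gA : g @: A = A'.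
  rewrite -(def_pblock tC A'C yA'); apply/esym/(def_pblock tC gAC).
  by rewrite -gx imset_f.
rewrite -gb -gA -imsetI; last by move=> ? ? _ _; apply: perm_inj.
by rewrite card_imset //; apply: perm_inj.
Qed.

(** With [g = gcdn l c], the square of [l / g] is prime to that of [c / g], hence
    divides [lam]; a prime is divisible by no square but [1]. *)
Lemma dvdn_of_sqr_dvd_prime_mul_sqr (lam l c : nat) : prime lam -> 0 < l ->
  l ^ 2 %| lam * c ^ 2 -> l %| c.
Proof.
move=> plam l_gt0; have g_gt0 : 0 < gcdn l c by rewrite gcdn_gt0 l_gt0.
have [l' c' cop] : exists2 l', l = l' * gcdn l c & coprime l' (c %/ gcdn l c).
  exists (l %/ gcdn l c); first by rewrite divnK ?dvdn_gcdl.
  rewrite /coprime -(eqn_pmul2r g_gt0) mul1n muln_gcdl.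
  by rewrite !divnK ?dvdn_gcdl ?dvdn_gcdr.
rewrite {1}c' -[c in lam * c ^ 2](divnK (dvdn_gcdr l c)) !expnMn mulnA.
rewrite dvdn_pmul2r ?expn_gt0 ?g_gt0 // Gauss_dvdl ?coprimeXl ?coprimeXr //.
move=> l'sq; have l'lam : l' %| lam by apply: dvdn_trans l'sq; apply: dvdn_mulr.
suff l'1 : l' = 1 by rewrite c' l'1 mul1n dvdn_gcdr.
have [_ /(_ _ l'lam)] := primeP plam; case/orP => /eqP // el.
have := dvdn_leq (prime_gt0 plam) l'sq; rewrite el.
by have := prime_gt1 plam; nia.
Qed.

(** Writing [k = lam m], the first relation gives [c = 1 + m (lam - 1)], which is
    prime to [m]; the second then forces [m | d - 1], and comparing sizes leaves
    [d - 1 = m] as the only possibility. *)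
Lemma imprimitive_design_parameters (k lam c d l : nat) :
  prime lam -> 1 < c -> 1 < d -> 0 < l ->
  k * l.-1 = lam * c.-1 -> k * (k - l) = lam * (c * d.-1) ->
  l %| k -> l ^ 2 %| lam * c ^ 2 ->
  [/\ l = lam, k = lam * (lam + 1), c = lam ^ 2 & d = lam + 2].
Proof.
move=> plam c_gt1 d_gt1 l_gt0 eq1 eq2 lk.
move=> /(dvdn_of_sqr_dvd_prime_mul_sqr plam l_gt0) lc.
have lam_gt0 := prime_gt0 plam; have lam_gt1 := prime_gt1 plam.
have el : l = lam.
  have ll : l %| lam.
    have : l %| lam * c.-1 + lam by rewrite -mulnSr prednK ?dvdn_mull // ltnW.
    by rewrite dvdn_addr // -eq1 dvdn_mulr.
  have [_ /(_ _ ll)] := primeP plam; case/orP => /eqP // l1.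
  by move/eqP: eq1; rewrite l1 muln0 eq_sym muln_eq0; lia.
subst l; case/dvdnP: lk => m ek.
have ec : c = m * lam.-1 + 1.
  have : lam * (m * lam.-1) = lam * c.-1 by rewrite -eq1 ek mulnA [lam * m]mulnC.
  by move/eqP; rewrite eqn_pmul2l // => /eqP; lia.
have eq3 : m * (lam * m.-1) = c * d.-1.
  have : lam * (m * (lam * m.-1)) = lam * (c * d.-1).
    by rewrite -eq2 ek -subn1 mulnBr muln1 mulnA [m * lam]mulnC.
  by move/eqP; rewrite eqn_pmul2l // => /eqP.
have cop : coprime m c by rewrite ec /coprime mulnC gcdnMDl gcdn1.
have /dvdnP[e ed] : m %| d.-1 by rewrite -(Gauss_dvdr _ cop) -eq3 dvdn_mulr.
have m_gt0 : 0 < m by case: (m) ed; lia.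
have e_gt0 : 0 < e by case: (e) ed; lia.
have eq4 : lam * m.-1 = (m * lam.-1 + 1) * e.
  by apply/eqP; rewrite -(eqn_pmul2l m_gt0) eq3 ec ed [e * m]mulnC mulnCA.
have [p ep] : exists p, lam = p.+2 by exists (lam - 2); lia.
have [q eq] : exists q, m = q.+1 by exists m.-1; lia.
move: eq4; rewrite ep eq /= => eq4.
(* For [lam >= 2], [lam * (m - 1)] is less than twice [m * (lam - 1) + 1]. *)
have e1 : e = 1.
  case: (ltngtP e 1) => // he; first lia.
  have : (q.+1 * p.+1 + 1) * 2 <= p.+2 * q by rewrite eq4 leq_mul2l he orbT.
  by clear; nia.
have em : m = lam + 1 by move: eq4; rewrite e1 eq ep; clear; nia.
split=> //; first by rewrite ek em ep mulnC.
  by rewrite ec em -mulnn ep /=; clear; nia.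
by move: ed; rewrite e1 em; lia.
Qed.

Theorem corollary1p2 (T : finType) (B : {set {set T}}) (v k lam : nat)
    (G : {group {perm T}}) (C : {set {set T}}) (c d : nat)
    (hD : symmetric_design B v k lam) (hlam : prime lam)
    (hG : automorphism_group B G)
    (hflag : flag_transitive B G) (himp : point_imprimitive G)
    (hC : partition C [set: T]) (hGC : [acts G, on C | 'P^*])
    (hd : #|C| = d) (hc : forall Delta, Delta \in C -> #|Delta| = c)
    (hd1 : 1 < d) (hc1 : 1 < c) :
  exists l : nat,
    (forall b Delta, b \in B -> Delta \in C ->
       #|b :&: Delta| = 0 \/ #|b :&: Delta| = l) /\
    [\/ (k%:Q <= lam%:Q * (lam%:Q - 3) / 2)%R,
        (v, k) = (lam ^ 2 * (lam + 2), lam * (lam + 1)) /\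
          ((c, d, l) = (lam ^ 2, lam + 2, lam) \/
           (c, d, l) = (lam + 2, lam ^ 2, 2))
      | [/\ (v%:Q = (lam%:Q + 6) * (lam%:Q ^+ 2 + 4 * lam%:Q - 1) / 4)%R,
            (k%:Q = lam%:Q * (lam%:Q + 5) / 2)%R,
            c = lam + 6,
            (d%:Q = (lam%:Q ^+ 2 + 4 * lam%:Q - 1) / 4)%R
          & l = 3] /\
        (lam = 1 %[mod 6] \/ lam = 3 %[mod 6])].
Proof.
have tC : trivIset C by case/and3P: hC.
have ev : v = d * c.
  by rewrite -(card_points hD) -cardsT (card_uniform_partition hc hC) hd.
have v_gt1 : 1 < v by rewrite ev; nia.
have rk x := card_blocks_through hD x (prime_gt0 hlam) v_gt1.
have /card_gt1P[A [A' [AC A'C AA']]] : 1 < #|C| by rewrite hd.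
have [x xA] : exists x, x \in A by apply/card_gt0P; rewrite (hc _ AC) ltnW.
have k_gt0 : 0 < k.
  have /card_gt1P[y [z [_ _ yz]]] : 1 < #|A| by rewrite (hc _ AC).
  rewrite -(rk y); apply: leq_trans (prime_gt0 hlam) _.
  rewrite -(card_blocks_through2 hD yz); apply/subset_leq_card/subsetP => b.
  by rewrite !inE => /and3P[-> ->].
have [b0] : exists b, b \in [set b in B | x \in b] by apply/card_gt0P; rewrite rk.
rewrite inE => /andP[b0B xb0]; pose l := #|b0 :&: A|.
have trace b D y : b \in B -> D \in C -> y \in b -> y \in D -> #|b :&: D| = l.
  move=> bB DC yb yD.
  apply: (flag_transitive_trace hflag tC hGC bB b0B DC AC (x := y) (y := x)).
    by rewrite inE yb.
  by rewrite inE xb0.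
have trace0l b D : b \in B -> D \in C -> #|b :&: D| = 0 \/ #|b :&: D| = l.
  move=> bB DC; have [->|[y /setIP[yb yD]]] := set_0Vmem (b :&: D).
    by left; rewrite cards0.
  by right; apply: trace yb yD.
exists l; split=> //.
have [|||||el ek ec ed] :=
  imprimitive_design_parameters (k := k) (l := l) hlam hc1 hd1.
- by apply/card_gt0P; exists x; rewrite inE xb0.
- rewrite -(rk x) (count_through_point hD (Y := A :\ x) (n := l.-1)) ?setD11 //.
    by rewrite -(hc _ AC) [#|A|](cardsD1 x) xA.
  move=> b bB xb; rewrite -(trace b A x) // [in RHS](cardsD1 x) inE xb xA.
  by rewrite setIDA.
- rewrite -{1}(rk x) (count_through_point hD (Y := ~: A) (n := k - l)) ?inE ?xA //.
    rewrite cardsCs setCK (hc _ AC) (card_points hD) ev.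
    by rewrite -subn1 [c * _]mulnBr muln1 [c * d]mulnC.
  move=> b bB xb; rewrite -(trace b A x) // -(card_block hD bB).
  by rewrite -setDE cardsD.
- rewrite -(card_block hD b0B) (card_sum_partition _ hC); apply: dvdn_sum => D DC.
  by case: (trace0l b0 D b0B DC) => ->.
- have dAA' : [disjoint A & A'] by apply: (trivIsetP tC).
  have := sum_card_setI2_disjoint hD dAA'; rewrite !hc // -mulnn => <-.
  apply: dvdn_sum => b bB.
  by case: (trace0l b A bB AC) => ->; case: (trace0l b A' bB A'C) => ->;
    rewrite ?mul0n ?muln0.
constructor 2; split; last by left; rewrite ec ed el.
by rewrite ek ev ec ed mulnC.
Qed.
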